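(* Let $G$ be a connected Eulerian digraph on $n$ vertices. Then the $k^{th}$ power $G^k$ with $k=\lceil \tfrac{1}{2} \sqrt{n}\, \log_2^2 n \rceil$ is Hamiltonian.
   Context: Digraphs are simple (no loops or multiple arcs). A digraph is Eulerian if it contains a closed walk using every arc exactly once; for a connected digraph this is equivalent to every vertex having indegree equal to outdegree. For a digraph $G$ and $k\in\mathbb{N}$, the $k^{th}$ power $G^k$ is the digraph on the vertex set of $G$ with an arc from $u$ to $v$ whenever $G$ contains a directed $uv$-path of length at most $k$. A digraph is Hamiltonian if it contains a directed cycle through all of its vertices. $\log_2^2 n$ means $(\log_2 n)^2$. *)

(* Defs.v *)
From mathcomp Require Import all_boot.
From Stdlib Require Import Reals.
Set Implicit Arguments. Unset Strict Implicit. Unset Printing Implicit Defensive.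

(* A simple digraph on a finite vertex type T: an irreflexive arc relation e
   (no loops; multiple arcs impossible since e is a relation). *)
Definition loopless (T : finType) (e : rel T) : Prop := forall x, ~~ e x x.

Definition connected_digraph (T : finType) (e : rel T) : Prop :=
  forall x y : T, connect (fun u v => e u v || e v u) x y.

(* Eulerian: there is a closed walk using every arc exactly once.  The walk is
   given as its cyclic sequence of arcs w: consecutive arcs are incident
   (head of one = tail of next, cyclically), every entry of w is an arc,
   every arc occurs in w, and no arc occurs twice. *)
Definition eulerian (T : finType) (e : rel T) : Prop :=
  exists w : seq (T * T),
    [/\ cycle (fun a b : T * T => a.2 == b.1) w,
        uniq w &
        forall a : T * T, (a \in w) = e a.1 a.2].

(* k-th power: arc u -> v iff u <> v and there is a directed u-v path of
   length at most k in G (walks give the same reachability). *)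
Definition dpower (T : finType) (e : rel T) (k : nat) : rel T :=
  fun u v => (u != v) &&
    [exists p : (k.+1).-tuple T,
       [exists i : 'I_(k.+1),
          path e u (take i p) && (last u (take i p) == v)]].

Definition hamiltonian (T : finType) (e : rel T) : Prop :=
  exists s : seq T, [/\ uniq s, (forall x, x \in s) & cycle e s].

Definition kbound (n : nat) : R :=
  (/ 2 * sqrt (INR n) * (ln (INR n) / ln 2) ^ 2)%R.

(* Main.v *)
Require Import Defs.
From mathcomp Require Import all_boot zify.
From Stdlib Require Import Reals Lra.
Set Implicit Arguments. Unset Strict Implicit. Unset Printing Implicit Defensive.

(* Among the balanced connected spanning subsets of the arcs take a minimal one A.
   A directed cycle of A missing a spanning tree B of A could be removed, so A \ B is acyclic;
   order the vertices topologically for A \ B.  Then fewer than n arcs of A go back, and since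
   A is balanced fewer than n arcs of A leave any prefix.  In a set U of vertices at most
   s |U| arcs advance by at most s places of U, and at most n |U| / s advance further; with s
   close to sqrt n, A has O(sqrt n |U|) arcs inside U.  Cut an Euler tour of A into windows of
   length L, a large enough multiple of sqrt n: the windows of a family visiting only U contain about
   L arcs of U each, so Hall's condition holds and the windows have distinct representatives.
   Visiting every vertex at one fixed time of the tour, a representative in each window, gives
   gaps less than 2 L.  This works for k of order sqrt n; the logarithms only serve to make
   [kbound n] large enough, and for n < 23 they give k >= n - 1. *)

(** * Hall's marriage theorem *)

Section Hall.
Variables I T : finType.
Implicit Type N : I -> {set T}.

Definition hall N := [forall X : {set I}, #|X| <= #|\bigcup_(i in X) N i|].

Lemma hallP N (X : {set I}) : hall N -> #|X| <= #|\bigcup_(i in X) N i|.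
Proof. by move/forallP/(_ X). Qed.

Definition shrink N i (x : T) := fun j => if j == i then N i :\ x else N j.

(** Only the set at [i] has changed, so a family violating Hall's condition after the removal must
    contain [i]; [X] is the rest of that family. *)
Lemma shrink_violation N i x : hall N -> ~~ hall (shrink N i x) ->
  exists X : {set I}, i \notin X /\ #|(N i :\ x) :|: \bigcup_(j in X) N j| <= #|X|.
Proof.
move=> hN /forallPn [Y]; rewrite -ltnNge => hY.
have sh (X : {set I}) : i \notin X ->
    \bigcup_(j in X) shrink N i x j = \bigcup_(j in X) N j.
  move=> iX; apply: eq_bigr => j jX; rewrite /shrink.
  case: eqP => // ji; by rewrite -ji jX in iX.
have iY : i \in Y.
  apply: contraLR hY => iY; rewrite sh // -leqNgt; exact: hallP.
exists (Y :\ i); split; first by rewrite !inE eqxx.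
have -> : (N i :\ x) :|: \bigcup_(j in Y :\ i) N j = \bigcup_(j in Y) shrink N i x j.
  rewrite (big_setD1 i iY) /= sh ?setD11 //; by rewrite /shrink eqxx.
by move: hY; rewrite (cardsD1 i Y) iY.
Qed.

(* Rado's proof: by submodularity of [X |-> #|\bigcup_X N|], at most one
   element of a neighbourhood is indispensable for Hall's condition. *)
Lemma hall_shrink N i : hall N -> 1 < #|N i| -> exists x, x \in N i /\ hall (shrink N i x).
Proof.
move=> hN /card_gt1P [x [y [xN yN xy]]].
case hx: (hall (shrink N i x)); first by exists x.
case hy: (hall (shrink N i y)); first by exists y.
have [X [iX cX]] := shrink_violation hN (negbT hx).
have [Y [iY cY]] := shrink_violation hN (negbT hy).
set A := _ :|: _ in cX; set B := _ :|: _ in cY.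
(* Since [x] and [y] differ, [A :|: B] recovers all of [N i]. Hence [#|A| + #|B|] is at least
   [#|X :|: Y| + 1 + #|X :&: Y|], one more than the bound [#|X| + #|Y|] given by the two
   violations. *)
have h1 : #|i |: (X :|: Y)| <= #|A :|: B|.
  apply: leq_trans (hallP _ hN) (subset_leq_card _).
  apply/bigcupsP => j; rewrite !inE => /or3P [/eqP ->|jX|jY].
  - apply/subsetP => z zN; rewrite !inE zN !andbT.
    by case: (eqVneq z x) => [->|//]; rewrite xy /= orbT.
  - apply: subset_trans (bigcup_sup j jX) _.
    by rewrite /A -setUA setUCA subsetUl.
  - apply: subset_trans (bigcup_sup j jY) _.
    by rewrite /B setUA subsetUr.
have h2 : #|X :&: Y| <= #|A :&: B|.
  apply: leq_trans (hallP _ hN) (subset_leq_card _).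
  apply/bigcupsP => j; rewrite inE => /andP [jX jY].
  rewrite subsetI; apply/andP; split.
    exact: subset_trans (bigcup_sup j jX) (subsetUr _ _).
  exact: subset_trans (bigcup_sup j jY) (subsetUr _ _).
have h3 := cardsUI A B; have h4 := cardsUI X Y.
have h5 : #|i |: (X :|: Y)| = #|X :|: Y|.+1 by rewrite cardsU1 !inE (negbTE iX) (negbTE iY).
lia.
Qed.

(** Neighbourhoods are shrunk, by induction on their total size, until all are singletons; Hall's
    condition on pairs then says that these singletons are distinct. *)
Theorem hall_marriage N : hall N -> exists2 f : I -> T, injective f & forall i, f i \in N i.
Proof.
have [m] := ubnP (\sum_i #|N i|); elim: m N => // m IHm N sm hN.
have N0 i : 0 < #|N i| by have := hallP [set i] hN; rewrite cards1 big_set1.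
case: (boolP [exists i, 1 < #|N i|]) => [/existsP [i]|/existsPn N1].
  case/(hall_shrink hN) => x [xN hx].
  have sub j : shrink N i x j \subset N j.
    by rewrite /shrink; case: eqP => // ->; apply: subD1set.
  have lt : \sum_j #|shrink N i x j| < m.
    rewrite -ltnS; apply: leq_trans sm; rewrite ltnS (bigD1 i) //= [X in _ <= X](bigD1 i) //=.
    have le : \sum_(j | j != i) #|shrink N i x j| <= \sum_(j | j != i) #|N j|.
      by apply: leq_sum => j _; apply: subset_leq_card (sub j).
    by have := cardsD1 x (N i); rewrite {1}/shrink eqxx xN; lia.
  have [f finj fN] := IHm _ lt hx.
  by exists f => // j; apply: (subsetP (sub j)).
have pick i : {x | N i = [set x]}.
  have: [exists x, N i == [set x]].
    have /cards1P [x ->] : #|N i| == 1 by rewrite eqn_leq N0 leqNgt N1.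
    by apply/existsP; exists x.
  by case/existsP/sigW => x /eqP Nx; exists x.
exists (fun i => sval (pick i)) => [i j|i]; last by case: (pick i) => x /= ->; rewrite inE.
case: (pick i) => x /= Nx; case: (pick j) => y /= Ny xy; apply/eqP; apply: contraT => ij.
have := hallP [set i; j] hN; rewrite cards2 ij /= bigcup_setU !big_set1 Nx Ny xy.
by rewrite setUid cards1.
Qed.

End Hall.

(** * Numerical consequences of the value of k *)

(* The hypothesis on [h] says [h / 2 <= log_2 n], so half-integer bounds (needed for small [n]) are allowed. *)
Lemma kbound_sqr n k h : 0 < n -> 2 ^ h <= n ^ 2 -> (kbound n <= INR k)%R ->
  n * h ^ 4 <= 64 * k ^ 2.
Proof.
move=> n0 hn hk.
have n0R : (0 < INR n)%R by apply: lt_0_INR; lia.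
have ln2 : (0 < ln 2)%R by rewrite -ln_1; apply: ln_increasing; lra.
have lnh : (INR h * ln 2 <= 2 * ln (INR n))%R.
  have two : (2 = INR 2)%R by [].
  rewrite -ln_pow; last lra.
  rewrite {2}two -ln_pow // -!pow_INR.
  have p2 : (0 < 2 ^ h)%R by apply: pow_lt; lra.
  rewrite {1}two -pow_INR in p2 *.
  have : (INR (Nat.pow 2 h) <= INR (Nat.pow n 2))%R by apply: le_INR; lia.
  case=> [lt|->]; last exact: Rle_refl.
  by left; apply: ln_increasing.
have lh : (INR h / 2 <= ln (INR n) / ln 2)%R.
  apply: (Rmult_le_reg_r (ln 2)) => //; rewrite /Rdiv Rmult_assoc.
  by rewrite [X in (_ <= X)%R]Rmult_assoc Rinv_l; lra.
move: hk; rewrite /kbound; set l := (ln _ / _)%R in lh * => hk.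
have h0 := pos_INR h; have s0 := sqrt_pos (INR n); have ss := sqrt_sqrt _ (Rlt_le _ _ n0R).
have l2 : (INR h ^ 2 / 4 <= l ^ 2)%R by nra.
have hk' : (sqrt (INR n) * INR h ^ 2 <= 8 * INR k)%R by nra.
have sq : (INR n * INR h ^ 4 <= 64 * INR k ^ 2)%R.
  have -> : (INR n * INR h ^ 4 = (sqrt (INR n) * INR h ^ 2) * (sqrt (INR n) * INR h ^ 2))%R.
    rewrite -{1}ss; ring.
  have : (0 <= sqrt (INR n) * INR h ^ 2)%R by apply: Rmult_le_pos => //; nra.
  nra.
have : (INR (n * Nat.pow h 4) <= INR (64 * Nat.pow k 2))%R.
  rewrite mult_INR pow_INR.
  have -> : INR (64 * Nat.pow k 2) = (64 * INR k ^ 2)%R.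
    by rewrite mult_INR pow_INR INR_IZR_INZ.
  exact: sq.
move/INR_le; lia.
Qed.

(** If [k <= n - 2], then [n * h ^ 4 <= 64 * (n - 2) ^ 2]; on each range of [n] below, a suitable
    [h] refutes this. *)
Lemma kbound_small n k : 1 < n < 23 -> (kbound n <= INR k)%R -> n <= k.+1.
Proof.
move=> hn hk.
have H h a : a <= n -> 2 ^ h <= a * a -> n * h ^ 4 <= 64 * (k * k).
  move=> an ha; have := @kbound_sqr n k h _ _ hk; rewrite /= !Nat.mul_1_r.
  by apply; [lia | exact: leq_trans ha (leq_mul an an)].
rewrite leqNgt; apply/negP => nk.
have kk : k * k <= (n - 2) * (n - 2) by apply: leq_mul; lia.
have [le|n16] := leqP 16 n; first by have /= := H 8 16 le isT; nia.
have [le|n12] := leqP 12 n; first by have /= := H 7 12 le isT; nia.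
have [le|n8] := leqP 8 n; first by have /= := H 6 8 le isT; nia.
have [le|n6] := leqP 6 n; first by have /= := H 5 6 le isT; nia.
have [le|n4] := leqP 4 n; first by have /= := H 4 4 le isT; nia.
have [le|n3] := leqP 3 n; first by have /= := H 3 3 le isT; nia.
by have /= := H 2 2 _ isT; nia.
Qed.

(** Here [h = 9]: 23 is the least integer whose square reaches [2 ^ 9], and [9 ^ 4 / 64] exceeds
    102. *)
Lemma kbound_large n k : 23 <= n -> (kbound n <= INR k)%R -> 102 * n <= k ^ 2.
Proof.
move=> hn hk; have := @kbound_sqr n k 9 (ltn_trans _ hn) _ hk; rewrite /= => H.
have : n * (81 * 81) <= 64 * (k * (k * 1)); last nia.
by apply: H => //; rewrite Nat.mul_1_r; apply: leq_trans (leq_mul hn hn).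
Qed.

Lemma ceil_sqrt n : 0 < n -> exists s, s ^ 2 < n <= s.+1 ^ 2.
Proof.
elim: n => // -[|n] IHn _; first by exists 0.
have [s /andP [s1 s2]] := IHn isT.
have [le|lt] := leqP n.+2 (s.+1 ^ 2); first by exists s; rewrite le (leq_trans s1).
exists s.+1; rewrite /= in s1 s2 lt *; nia.
Qed.

(** * Balanced and connected sets of arcs *)

Section Arcs.
Variable T : finType.
Implicit Types (A B C : {set T * T}) (S U : {set T}) (c d : seq T).

Definition outdeg A v := #|[set a in A | a.1 == v]|.
Definition indeg A v := #|[set a in A | a.2 == v]|.
Definition balanced A := [forall v, outdeg A v == indeg A v].
Definition darc A : rel T := fun u v => (u, v) \in A.
Definition uarc A : rel T := fun u v => darc A u v || darc A v u.
Definition conn A := [forall x, forall y, connect (uarc A) x y].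

Lemma balancedD A C : C \subset A -> balanced A -> balanced C -> balanced (A :\: C).
Proof.
move=> CA /forallP bA /forallP bC; apply/forallP => v.
have E (p : pred (T * T)) :
    #|[set a in A | p a]| = #|[set a in C | p a]| + #|[set a in A :\: C | p a]|.
  rewrite -(cardsID C [set a in A | p a]); congr (_ + _).
    apply: eq_card => a; rewrite !inE andbC; case aC: (a \in C) => //=.
    by rewrite (subsetP CA _ aC).
  by apply: eq_card => a; rewrite !inE andbA.
have := bA v; have := bC v; rewrite /outdeg /indeg !(E (fun a => _ == v)).
by move=> /eqP ->; rewrite eqn_add2l.
Qed.

Lemma sum_outdeg A S : \sum_(v in S) outdeg A v = #|[set a in A | a.1 \in S]|.
Proof.
rewrite -sum1_card (partition_big (fun a : T * T => a.1) (mem S)) /=; last first.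
  by move=> a; rewrite inE => /andP [].
apply: eq_bigr => v vS; rewrite sum1_card; apply: eq_card => a; rewrite [RHS]unfold_in /= !inE.
by case: eqP => [->|]; rewrite ?vS ?andbT ?andbF.
Qed.

Lemma sum_indeg A S : \sum_(v in S) indeg A v = #|[set a in A | a.2 \in S]|.
Proof.
rewrite -sum1_card (partition_big (fun a : T * T => a.2) (mem S)) /=; last first.
  by move=> a; rewrite inE => /andP [].
apply: eq_bigr => v vS; rewrite sum1_card; apply: eq_card => a; rewrite [RHS]unfold_in /= !inE.
by case: eqP => [->|]; rewrite ?vS ?andbT ?andbF.
Qed.

(** Summing outdegrees and indegrees over [S] gives equal totals, from which the arcs inside [S]
    cancel. *)
Lemma balanced_cut A S : balanced A ->
  #|[set a in A | (a.1 \in S) && (a.2 \notin S)]| =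
  #|[set a in A | (a.1 \notin S) && (a.2 \in S)]|.
Proof.
move/forallP => bA.
have : \sum_(v in S) outdeg A v = \sum_(v in S) indeg A v.
  by apply: eq_bigr => v _; apply/eqP.
rewrite sum_outdeg sum_indeg.
rewrite -(cardsID [set a | a.2 \in S] [set a in A | a.1 \in S]).
rewrite -(cardsID [set a | a.1 \in S] [set a in A | a.2 \in S]).
have -> : [set a in A | a.1 \in S] :&: [set a | a.2 \in S] =
          [set a in A | a.2 \in S] :&: [set a | a.1 \in S].
  by apply/setP => a; rewrite !inE andbAC.
move/addnI; set X := _ :\: _; set Y := _ :\: _ => XY.
have -> : [set a in A | (a.1 \in S) && (a.2 \notin S)] = X.
  by apply/setP => a; rewrite !inE andbA andbC.
by rewrite XY; apply: eq_card => a; rewrite !inE andbCA.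
Qed.

(** No arc leaves the set of vertices reachable from [v], so by balance none enters it; in
    particular [(u, v)] does not. *)
Lemma balanced_connect_back A u v : balanced A -> (u, v) \in A -> connect (darc A) v u.
Proof.
move=> bA uvA; set S := [set x | connect (darc A) v x].
have := balanced_cut S bA.
have -> : [set a in A | (a.1 \in S) && (a.2 \notin S)] = set0.
  apply/setP => -[x y]; rewrite !inE /=; apply/negbTE/and3P => -[xyA vx /negP []].
  exact: connect_trans vx (connect1 xyA).
rewrite cards0 => /esym /cards0_eq /setP /(_ (u, v)).
by rewrite !inE uvA connect0 andbT /= => /negbFE.
Qed.

Lemma balanced_strong A x y : balanced A -> conn A -> connect (darc A) x y.
Proof.
move=> bA /forallP /(_ x) /forallP /(_ y).
apply: connect_sub => u v /orP [uv|vu]; first exact: connect1.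
exact: balanced_connect_back.
Qed.

(** * Closed walks and Euler tours *)

(** A closed walk is encoded by its cyclic vertex sequence; the rotation supplies the arc from the
    last vertex back to the first. *)
Definition arcs c := zip c (rot 1 c).

Lemma size_arcs c : size (arcs c) = size c.
Proof. by rewrite size_zip size_rot minnn. Qed.

Lemma tails_arcs c : map fst (arcs c) = c.
Proof. by rewrite -[map _ _]/(unzip1 _) unzip1_zip // size_rot. Qed.

Lemma heads_arcs c : map snd (arcs c) = rot 1 c.
Proof. by rewrite -[map _ _]/(unzip2 _) unzip2_zip // size_rot. Qed.

Lemma zip_rot n c d : size c = size d -> zip (rot n c) (rot n d) = rot n (zip c d).
Proof.
move=> cd; rewrite /rot zip_cat ?size_drop ?cd //; congr (_ ++ _).
- by elim: n c d cd => [|n IHn] [|x c] [|y d] //= [] /IHn.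
- by elim: n c d cd => [|n IHn] [|x c] [|y d] //= [] /IHn ->.
Qed.

Lemma arcs_rot n c : arcs (rot n c) = rot n (arcs c).
Proof. by rewrite /arcs rot_rot zip_rot // size_rot. Qed.

Lemma arcs_cat v c d : arcs ((v :: c) ++ v :: d) = arcs (v :: c) ++ arcs (v :: d).
Proof.
rewrite /arcs cat_cons !rot1_cons -cat_cons.
have -> : rcons (c ++ v :: d) v = rcons c v ++ rcons d v by rewrite cat_rcons rcons_cat.
by rewrite zip_cat // size_rcons.
Qed.

Lemma cycle_arcs e c : cycle e c = all (fun a => e a.1 a.2) (arcs c).
Proof.
case: c => //= v c; rewrite /arcs rot1_cons.
by elim: c {1 3}v => [|x c IHc] u //=; rewrite IHc.
Qed.

(** The heads of the arcs are a rotation of their tails, so each vertex occurs equally often in both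
    lists. *)
Lemma balanced_arcs c : uniq (arcs c) -> balanced [set a in arcs c].
Proof.
move=> uc; apply/forallP => v; rewrite /outdeg /indeg.
have E (f : T * T -> T) : #|[set a in [set a in arcs c] | f a == v]| = count_mem v (map f (arcs c)).
  rewrite count_map -size_filter -(card_uniqP _); last by rewrite filter_uniq.
  by apply: eq_card => a; rewrite !inE mem_filter andbC.
rewrite !E tails_arcs heads_arcs; apply/eqP; apply/permP.
by rewrite perm_sym perm_rot.
Qed.

Lemma uniq_arcs c : uniq c -> uniq (arcs c).
Proof. by move=> uc; apply: (@map_uniq _ _ fst); rewrite tails_arcs. Qed.

Lemma arcs_mem c a : a \in arcs c -> (a.1 \in c) && (a.2 \in c).
Proof.
move=> ac; have := map_f fst ac; have := map_f snd ac.
by rewrite tails_arcs heads_arcs mem_rot => -> ->.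
Qed.

Lemma connect_cycle A u v : (u, v) \in A -> connect (darc A) v u ->
  exists c, [/\ uniq c, u \in c & {subset arcs c <= A}].
Proof.
move=> uvA /connectP [p pth lst].
case: (shortenP pth) lst => q qth uq _ lst.
exists (v :: q); split=> //; first by rewrite lst mem_last.
have : cycle (darc A) (v :: q) by rewrite /= rcons_path qth -lst.
by rewrite cycle_arcs => /allP H [x y] /H.
Qed.

Lemma conn_leaving A S x y : conn A -> x \in S -> y \notin S ->
  exists2 a, a \in A & (a.1 \in S) != (a.2 \in S).
Proof.
move=> /forallP /(_ x) /forallP /(_ y) xy xS yS.
case: (boolP [exists a in A, (a.1 \in S) != (a.2 \in S)]) => [/exists_inP //|].
move/exists_inPn => H.
have cl : closed (uarc A) (mem S).
  by move=> u v /orP [] /H /=; rewrite negbK => /eqP.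
by move: yS; rewrite -(closed_connect cl xy) xS.
Qed.

Lemma extend_trail A c : balanced A -> conn A -> uniq (arcs c) -> {subset arcs c <= A} ->
  size c < #|A| ->
  exists d, [/\ uniq (arcs d), {subset arcs d <= A} & size c < size d].
Proof.
move=> bA cA uc cs lt; set C := [set a in arcs c]; set A' := A :\: C.
have CA : C \subset A by apply/subsetP => a; rewrite inE => /cs.
have cC : #|C| = size c by rewrite cardsE (card_uniqP uc) size_arcs.
have bA' : balanced A' by apply: balancedD => //; apply: balanced_arcs.
have [a aA'] : exists a, a \in A'.
  by apply/set0Pn; rewrite -cards_eq0 cardsD (setIidPr CA) cC subn_eq0 -ltnNge.
have join b : b \in A' -> (c == [::]) || (b.1 \in c) ->
    exists d, [/\ uniq (arcs d), {subset arcs d <= A} & size c < size d].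
  case: b => u v uvA' cu; have [d [ud ud' ds]] :=
    connect_cycle uvA' (balanced_connect_back bA' uvA').
  have dA z : z \in arcs d -> z \in A by move/ds; rewrite inE => /andP [].
  have [/eqP c0|cn] := boolP (c == [::]).
    exists d; split=> //; first exact: uniq_arcs.
    by rewrite c0; case: (d) ud'.
  move: cu; rewrite (negbTE cn) /= => uc'.
  have [i c' ec] := rot_to uc'; have [j d' ed] := rot_to ud'.
  have sz : size (rot i c ++ rot j d) = size c + size d by rewrite size_cat !size_rot.
  have ec' : arcs (rot i c ++ rot j d) = rot i (arcs c) ++ rot j (arcs d).
    by rewrite -!arcs_rot ec ed arcs_cat.
  exists (rot i c ++ rot j d); rewrite sz ec'; split.
  - rewrite cat_uniq !rot_uniq uc uniq_arcs // andbT; apply/hasPn => z.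
    rewrite !mem_rot => /ds; rewrite !inE => /andP [] //.
  - by move=> z; rewrite mem_cat !mem_rot => /orP [/cs|/dA].
  - by rewrite -[X in X < _]addn0 ltn_add2l; case: (d) ud'.
have [c0|cn] := boolP (c == [::]); first by apply: (join a aA'); rewrite c0.
case: (boolP [exists b in A', b.1 \in c]) => [/exists_inP [b bA'' bc]|/exists_inPn none].
  by apply: (join b); rewrite ?bc ?orbT.
have v0c : exists v, v \in c by case: (c) cn => // v c' _; exists v; rewrite mem_head.
have [v vc] := v0c.
have none2 b : b \in A' -> b.2 \notin c.
  move=> bA''; apply/negP => bc; move/forallP/(_ b.2): bA'; rewrite /outdeg /indeg.
  have -> : [set x in A' | x.1 == b.2] = set0.
    apply/setP => x; rewrite inE [RHS]inE; apply/negbTE/andP => -[/none xc /eqP xb].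
    by rewrite xb bc in xc.
  rewrite cards0 eq_sym cards_eq0 => /eqP /setP /(_ b).
  by rewrite inE bA'' eqxx inE.
have [||b bInA] := @conn_leaving A [set x in c] v a.1 cA; rewrite ?inE ?vc ?none //.
case: (boolP (b \in A')) => [bA''|].
  by rewrite (negbTE (none _ bA'')) (negbTE (none2 _ bA'')).
rewrite inE bInA andbT negbK inE => /arcs_mem /andP [-> ->].
by rewrite eqxx.
Qed.

Lemma euler_tour A : balanced A -> conn A ->
  exists c, uniq (arcs c) /\ (arcs c =i A).
Proof.
move=> bA cA.
have cardA c : uniq (arcs c) -> {subset arcs c <= A} -> size c <= #|A|.
  move=> uc cs; rewrite -size_arcs -(card_uniqP uc); apply: subset_leq_card.
  exact/subsetP.
have ext m : m <= #|A| -> exists c, [/\ uniq (arcs c), {subset arcs c <= A} & m <= size c].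
  elim: m => [|m IHm] mA; first by exists [::].
  have [c [uc cs mc]] := IHm (ltnW mA).
  have [le|lt] := leqP #|A| (size c); first by exists c; split=> //; apply: leq_trans le.
  have [d [ud ds cd]] := extend_trail bA cA uc cs lt.
  by exists d; split=> //; apply: leq_ltn_trans cd.
have [c [uc cs Ac]] := ext _ (leqnn _).
have eq : #|arcs c| = #|A|.
  by apply/eqP; rewrite (card_uniqP uc) size_arcs eqn_leq cardA.
by exists c; split=> //; apply/(subset_cardP eq)/subsetP.
Qed.

(** * Spanning trees, topological orders and minimal arc sets *)

Lemma spanning_tree A (r : T) : conn A ->
  exists B, [/\ B \subset A, conn B & #|B| < #|T|].
Proof.
move=> cA.
have grow m : m < #|T| -> exists S B, [/\ r \in S, #|S| = m.+1, B \subset A, #|B| <= m &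
    forall x, x \in S -> connect (uarc B) r x].
  elim: m => [|m IHm] mT.
    exists [set r], set0; rewrite set11 cards1 cards0 sub0set; split=> // x.
    by rewrite inE => /eqP ->.
  have [S [B [rS cS BA cB Sr]]] := IHm (ltnW mT).
  have [y yS] : exists y, y \notin S.
    apply/existsP; apply: contraLR mT; rewrite negb_exists -leqNgt -cS => /forallP all_in.
    by apply: subset_leq_card; apply/subsetP => y _; have := all_in y; rewrite negbK.
  have [a aA cross] := conn_leaving cA rS yS.
  have sub : subrel (connect (uarc B)) (connect (uarc (a |: B))).
    apply: connect_sub => u v uv; apply: connect1.
    by move: uv; rewrite /uarc /darc !inE => /orP [] ->; rewrite !orbT.
  pose z := if a.1 \in S then a.2 else a.1.
  have zS : z \notin S by rewrite /z; case: ifP cross => // ->; case: (_ \in S).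
  exists (z |: S), (a |: B); split.
  - by rewrite inE rS orbT.
  - by rewrite cardsU1 zS cS.
  - by rewrite subUset sub1set aA.
  - by apply: leq_trans (leq_card_setU _ _) _; rewrite cards1.
  move=> x; rewrite !inE => /orP [/eqP ->|/Sr /sub //].
  have aB : uarc (a |: B) a.1 a.2 by rewrite /uarc /darc -surjective_pairing setU11.
  have aB' : uarc (a |: B) a.2 a.1 by rewrite /uarc orbC.
  move: cross; rewrite /z; case: ifP => [aS _|aS].
    exact: connect_trans (sub _ _ (Sr _ aS)) (connect1 aB).
  case: (boolP (a.2 \in S)) => // a2S _.
  exact: connect_trans (sub _ _ (Sr _ a2S)) (connect1 aB').
have T0 : 0 < #|T| by apply/card_gt0P; exists r.
have [|S [B [rS cS BA cB Sr]]] := grow #|T|.-1; first by rewrite prednK.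
exists B; split=> //; last by rewrite -ltnS prednK in cB.
have ST : S = setT by apply/eqP; rewrite eqEcard subsetT cS cardsT prednK /=.
have conn_r x : connect (uarc B) r x by apply: Sr; rewrite ST inE.
apply/forallP => x; apply/forallP => y; apply: connect_trans (conn_r y).
by rewrite (sym_connect_sym (fun u v => orbC _ _)).
Qed.

(** The number [phi v] of vertices from which [v] can be reached grows strictly along arcs of an
    acyclic set; [enum_rank] breaks ties to make the order injective. *)
Lemma topological_order A :
  (forall c, uniq c -> {subset arcs c <= A} -> c = [::]) ->
  exists2 psi : T -> nat, injective psi & forall a, a \in A -> psi a.1 < psi a.2.
Proof.
move=> acyc; pose phi v := #|[set x | connect (darc A) x v]|.
have phi_lt u v : (u, v) \in A -> phi u < phi v.
  move=> uvA; apply: proper_card; apply/properP; split.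
    apply/subsetP => x; rewrite !inE => xu; exact: connect_trans xu (connect1 uvA).
  exists v; rewrite inE ?connect0 //; apply/negP => vu.
  by have [c [uc uIc /(acyc _ uc) c0]] := connect_cycle uvA vu; rewrite c0 in uIc.
exists (fun v => phi v * #|T| + enum_rank v) => [u v uv|[u v] /phi_lt uv /=].
  apply: enum_rank_inj; apply: ord_inj.
  by have := congr1 (modn ^~ #|T|) uv; rewrite !modnMDl !modn_small.
apply: leq_trans (_ : (phi u).+1 * #|T| <= _); first by rewrite mulSn addnC ltn_add2r.
by apply: leq_trans (leq_addr _ _); rewrite leq_mul2r uv orbT.
Qed.

Definition back_arcs A (psi : T -> nat) := [set a in A | psi a.2 < psi a.1].

(* If a spanning tree [B] of a minimal [A] missed a directed cycle, that cycle could be removed. *)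
Lemma minimal_few_back_arcs A (r : T) :
  minset (fun C => balanced C && conn C) A ->
  exists2 psi : T -> nat, injective psi & #|back_arcs A psi| < #|T|.
Proof.
case/minsetP => /andP [bA cA] minA; have [B [BA cB card_B]] := spanning_tree r cA.
have [|psi inj_psi psi_lt] := @topological_order (A :\: B).
  move=> c uc cs; set C := [set a in arcs c].
  have CA : C \subset A by apply/subsetP => a; rewrite inE => /cs; rewrite inE => /andP [].
  have BAC : B \subset A :\: C.
    apply/subsetP => a aB; rewrite !inE (subsetP BA _ aB) andbT.
    by apply/negP => /cs; rewrite inE aB.
  have AC : A :\: C = A.
    apply: minA; last exact: subsetDl.
    rewrite balancedD //=; last exact/balanced_arcs/uniq_arcs.
    apply/forallP => x; apply/forallP => y.
    move/forallP/(_ x)/forallP/(_ y): cB; apply: connect_sub => u v uv; apply: connect1.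
    by move: uv; rewrite /uarc /darc => /orP [] /(subsetP BAC) ->; rewrite ?orbT.
  case: c uc cs @C CA BAC AC => // v c _ cs C CA _ AC.
  have [a aC] : exists a, a \in arcs (v :: c).
    by rewrite /arcs rot1_cons; case: (c) => [|w c'] /=; eexists; apply: mem_head.
  have := cs _ aC; rewrite inE => /andP [_]; rewrite -AC inE => /andP [].
  by rewrite inE aC.
(* Arcs of [A] outside [B] advance in [psi], so all back arcs lie in [B]. *)
exists psi => //; apply: leq_ltn_trans card_B; apply: subset_leq_card.
apply/subsetP => a; rewrite inE => /andP [aA]; apply: contraTT => aB.
by rewrite -leqNgt ltnW // psi_lt // inE aB.
Qed.

(** * Few arcs inside a set of vertices *)

Definition induced A U := [set a in A | (a.1 \in U) && (a.2 \in U)].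

Section Density.
Variables (A : {set T * T}) (psi : T -> nat) (U : {set T}).
Hypotheses (bA : balanced A) (inj_psi : injective psi).

(** With the tail counted and the head not, the size of this set is the number of places of [U] by
    which a forward arc inside [U] advances. *)
Definition between (a : T * T) := [set z in U | psi a.1 <= psi z < psi a.2].

(* The prefix [psi <= psi z] is left by as many arcs as enter it, and those entering it go back. *)
Lemma forward_cut z :
  #|[set a in A | psi a.1 <= psi z < psi a.2]| <= #|back_arcs A psi|.
Proof.
have := balanced_cut [set x | psi x <= psi z] bA.
have -> : [set a in A | (a.1 \in [set x | psi x <= psi z]) &&
    (a.2 \notin [set x | psi x <= psi z])] = [set a in A | psi a.1 <= psi z < psi a.2].
  by apply/setP => a; rewrite !inE -ltnNge.
move=> ->; apply: subset_leq_card; apply/subsetP => a; rewrite !inE => /and3P [-> /=].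
by rewrite -ltnNge => lt le; apply: leq_ltn_trans lt.
Qed.

(** A forward arc inside [U] is determined by its tail and the number of places it advances, which
    for a short arc takes [s.+1] values. *)
Lemma card_short_arcs s :
  #|[set a in induced A U | (psi a.1 <= psi a.2) && (#|between a| <= s)]| <= #|U| * s.+1.
Proof.
set X := [set a in _ | _].
have XP a : a \in X -> [/\ a.1 \in U, a.2 \in U, psi a.1 <= psi a.2 & #|between a| <= s].
  by rewrite !inE => /andP [/and3P [_ -> ->] /andP [-> ->]].
have strict a b : a \in X -> b \in X -> a.1 = b.1 -> psi a.2 < psi b.2 ->
    #|between a| < #|between b|.
  move=> /XP [a1 a2 le _] _ ab lt; apply: proper_card; apply/properP; split.
    apply/subsetP => z; rewrite !inE -ab => /and3P [-> -> /= z2]; exact: ltn_trans lt.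
  by exists a.2; rewrite !inE ?ltnn ?andbF // a2 -ab le.
have inj : {in X &, injective (fun a => (a.1, inord #|between a| : 'I_s.+1))}.
  move=> a b aX bX [ab /(congr1 val)]; have [_ _ _ sa] := XP _ aX; have [_ _ _ sb] := XP _ bX.
  rewrite /= !inordK ?ltnS // => len.
  suff a2b2 : a.2 = b.2 by rewrite [a]surjective_pairing [b]surjective_pairing ab a2b2.
  apply: inj_psi; case: (ltngtP (psi a.2) (psi b.2)) => // lt.
    by have := strict _ _ aX bX ab lt; rewrite len ltnn.
  by have := strict _ _ bX aX (esym ab) lt; rewrite len ltnn.
have -> : #|U| * s.+1 = #|setX U [set: 'I_s.+1]| by rewrite cardsX cardsT card_ord.
rewrite -(card_in_imset inj); apply: subset_leq_card.
by apply/subsetP => _ /imsetP [a /XP [aU _ _ _] ->]; rewrite !inE aU.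
Qed.

(** Double counting of pairs of a long arc and a vertex of [U] that it passes over: [forward_cut]
    bounds the arcs over each vertex. *)
Lemma card_long_arcs s :
  s.+1 * #|[set a in induced A U | s < #|between a|]| <= #|U| * #|back_arcs A psi|.
Proof.
set X := [set a in _ | _]; rewrite mulnC -!sum_nat_const.
apply: (@leq_trans (\sum_(a in X) \sum_(z in U | psi a.1 <= psi z < psi a.2) 1)).
  apply: leq_sum => a; rewrite !inE => /andP [_ lt]; rewrite sum1_card.
  by apply: leq_trans lt _; apply: subset_leq_card; apply/subsetP => z; rewrite !inE.
rewrite (exchange_big_dep (mem U)) /=; last by move=> a z _ /andP [].
apply: leq_sum => z zU; rewrite sum1_card; apply: leq_trans (forward_cut z).
apply: subset_leq_card; apply/subsetP => a; rewrite !inE => /and3P [].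
by rewrite !inE => /andP [/andP [-> _] _] _ ->.
Qed.

(** Short, long and back arcs each number at most [#|U| * s.+1]; for the back arcs this uses
    [s.+1 <= #|U|]. *)
Lemma card_induced s : #|T| <= s.+1 ^ 2 -> #|back_arcs A psi| <= #|T| -> s.+1 <= #|U| ->
  #|induced A U| <= #|U| * (3 * s.+1).
Proof.
move=> Ts back sU; have := card_short_arcs s; have := card_long_arcs s.
set X := [set a in _ | s < _]; set Y := [set a in _ | _ && _] => cX cY.
have sub : induced A U \subset X :|: (Y :|: back_arcs A psi).
  apply/subsetP => a; rewrite inE => /and3P [aA a1 a2]; rewrite !inE aA a1 a2 /= ltnNge.
  by case: (#|between a| <= s); rewrite ?andbT //= leqNgt orNb.
have c1 := subset_leq_card sub.
have c2 := (leq_card_setU X (Y :|: back_arcs A psi)).1.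
have c3 := (leq_card_setU Y (back_arcs A psi)).1.
have cX' : #|X| <= #|U| * s.+1.
  rewrite -(leq_pmul2l (ltn0Sn s)); apply: leq_trans cX _.
  rewrite mulnCA leq_mul // (leq_trans back) // (leq_trans Ts) //=; nia.
have Tu : #|T| <= #|U| * s.+1 by apply: leq_trans Ts _ => /=; nia.
rewrite mulnCA; lia.
Qed.

End Density.

(** This serves for sets [U] too small for [card_induced]. *)
Lemma induced_sq A U : #|induced A U| <= #|U| * #|U|.
Proof.
rewrite -cardsX; apply: subset_leq_card; apply/subsetP => a.
by rewrite !inE => /andP [].
Qed.

Lemma mem_tour A c v : conn A -> 1 < #|T| -> arcs c =i A -> v \in c.
Proof.
move=> cA T1 cE; have [y yv] : exists y, y \notin [set v].
  apply/existsP; apply: contraLR T1; rewrite negb_exists -leqNgt => /forallP H.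
  rewrite -(cards1 v); apply: subset_leq_card; apply/subsetP => y _.
  by have := H y; rewrite negbK.
have [a aA] := conn_leaving cA (set11 v) yv.
move: aA; rewrite -cE => /arcs_mem /andP [a1 a2]; rewrite !inE.
by case: (eqVneq a.1 v) => [<-|_] //; case: (eqVneq a.2 v) => [<-|_].
Qed.

(** * From Eulerian connected digraphs to balanced connected arc sets *)

Lemma balanced_eulerian (e : rel T) : eulerian e -> balanced [set a | e a.1 a.2].
Proof.
case=> w [cw uw wE].
(* The heads of [w] are its tails rotated by one, so [w] is recovered from its tails. *)
have aw : arcs (map fst w) = w.
  rewrite /arcs -map_rot; suff -> : map fst (rot 1 w) = map snd w by apply: zip_unzip.
  case: w cw {uw wE} => // a w /=; rewrite rot1_cons.
  have adj p b : path (fun a b : T * T => a.2 == b.1) b p -> map fst p = map snd (belast b p).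
    by elim: p b => //= x p IHp b /andP [/eqP -> /IHp ->].
  by move/adj => ->; rewrite belast_rcons.
have := @balanced_arcs (map fst w); rewrite aw => /(_ uw).
by congr (balanced _); apply/setP => a; rewrite !inE wE.
Qed.

Lemma conn_connected (e : rel T) : connected_digraph e -> conn [set a | e a.1 a.2].
Proof.
move=> ce; apply/forallP => x; apply/forallP => y.
by rewrite (eq_connect (e' := fun u v => e u v || e v u)) // => u v; rewrite /uarc /darc !inE.
Qed.

(** * Hamiltonian cycles in powers, obtained by following a closed walk *)

Lemma cycleP (e : rel T) x0 c :
  reflect (forall i, i < size c -> e (nth x0 c i) (nth x0 c (i.+1 %% size c))) (cycle e c).
Proof.
case: c => [|v c]; first by apply: ReflectT.
have E i : i < size (v :: c) ->
    (nth x0 (v :: rcons c v) i = nth x0 (v :: c) i) /\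
    (nth x0 (rcons c v) i = nth x0 (v :: c) (i.+1 %% (size c).+1)).
  move=> /= lt; split; first by rewrite -rcons_cons nth_rcons lt.
  rewrite nth_rcons; move: lt; rewrite ltnS leq_eqVlt => /orP [/eqP ->|lt].
    by rewrite ltnn eqxx modnn.
  by rewrite lt modn_small.
apply: (iffP (pathP x0)); rewrite size_rcons => H i lt.
  by have := H i lt; have [-> ->] := E i lt.
by have := H i lt; have [-> ->] := E i lt.
Qed.

Lemma dpower_walk (e : rel T) k u p : u != last u p -> path e u p -> size p <= k ->
  dpower e k u (last u p).
Proof.
move=> uv pth sz; rewrite /dpower uv /=.
(* The definition of [dpower] takes a prefix of a tuple of fixed length, so the walk is padded with
   copies of [u]. *)
have szt : size (p ++ nseq (k.+1 - size p) u) == k.+1 by rewrite size_cat size_nseq subnKC // leqW.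
apply/existsP; exists (Tuple szt); apply/existsP; exists (inord (size p)).
by rewrite /= inordK ?ltnS // take_size_cat // pth eqxx.
Qed.

Lemma walk_along (e : rel T) x0 c t (d : nat) : cycle e c -> 0 < size c ->
  exists p, [/\ path e (nth x0 c (t %% size c)) p,
    last (nth x0 c (t %% size c)) p = nth x0 c ((t + d) %% size c) & size p = d].
Proof.
move=> cyc c0; elim: d => [|d [p [pth lst sz]]]; first by exists [::]; rewrite addn0.
exists (rcons p (nth x0 c ((t + d.+1) %% size c))).
rewrite rcons_path pth last_rcons size_rcons sz lst; split=> //=.
have := cycleP e x0 c cyc _ (ltn_pmod (t + d) c0).
by rewrite -addn1 modnDml -addnA addn1.
Qed.

Lemma nth_next_neq x0 c i : uniq c -> 1 < size c -> i < size c ->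
  nth x0 c i != nth x0 c (i.+1 %% size c).
Proof.
move=> uc c1 ic; rewrite nth_uniq ?ltn_pmod ?(ltnW c1) //.
have [lt|ge] := ltnP i.+1 (size c); first by rewrite modn_small // neq_ltn ltnSn.
have -> : i.+1 = size c by apply/eqP; rewrite eqn_leq ic.
by rewrite modnn; lia.
Qed.

Lemma hamiltonian_complete (r : rel T) : 1 < #|T| -> (forall u v, u != v -> r u v) -> hamiltonian r.
Proof.
move=> T1 H; exists (enum T); split; [exact: enum_uniq | by move=> x; rewrite mem_enum|].
have x0 : T by have /card_gt0P /sigW [x _] := ltnW T1.
apply/(cycleP _ x0) => i lt; apply/H/nth_next_neq => //; first exact: enum_uniq.
by rewrite -cardE.
Qed.

(** By strong connectivity any two vertices are joined by a path without repetition, which has at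
    most [#|T| - 1 <= k] arcs; the power is complete. *)
Lemma hamiltonian_small (e : rel T) k : 1 < #|T| -> #|T| <= k.+1 ->
  connected_digraph e -> eulerian e -> hamiltonian (dpower e k).
Proof.
move=> T1 Tk ce ee; apply: hamiltonian_complete => // u v uv.
have := balanced_strong u v (balanced_eulerian ee) (conn_connected ce).
rewrite (eq_connect (e' := e)); last by move=> x y; rewrite /darc inE.
case/connectP => p pth lst; case: (shortenP pth) lst => q qth uq _ lst.
rewrite lst; apply: dpower_walk => //; first by rewrite -lst.
by rewrite -ltnS; apply: leq_trans Tk; have := max_card (mem (u :: q)); rewrite (card_uniqP uq).
Qed.

(** The vertices are taken in the order of their times [tau]. Every window of length [L] contains a
    time, so cyclically consecutive times differ by at most [2 * L - 1 <= k], and the closed walk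
    itself joins them. *)
Lemma hamiltonian_of_times (e : rel T) k L c x0 (tau : T -> nat) :
  1 < #|T| -> 0 < L -> 2 * L <= k.+1 -> cycle e c ->
  (forall v, tau v < size c /\ nth x0 c (tau v) = v) ->
  (forall j, j * L < size c -> exists v, tau v %/ L = j) ->
  hamiltonian (dpower e k).
Proof.
move=> T1 L0 Lk cyc tauP win; pose le := relpre tau leq.
have tau_inj : injective tau by move=> u v uv; rewrite -(tauP u).2 uv (tauP v).2.
set m := size c in tauP win; have m0 : 0 < m by apply: leq_trans (tauP x0).1.
pose s := sort le (enum T); have us : uniq s by rewrite sort_uniq enum_uniq.
have ms x : x \in s by rewrite mem_sort mem_enum.
have szs : size s = #|T| by rewrite size_sort -cardE.
exists s; split=> //; apply/(cycleP _ x0) => i; rewrite szs => iT.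
have s_le a b : a <= b -> b < #|T| -> tau (nth x0 s a) <= tau (nth x0 s b).
  have le_tr : transitive le by move=> y x z; apply: leq_trans.
  have le_refl : reflexive le by move=> x; apply: leqnn.
  have le_total : total le by move=> x y; apply: leq_total.
  have mono := sorted_leq_nth le_tr le_refl x0 (sort_sorted le_total (enum T)).
  by move=> ab bT; apply: mono => //; rewrite inE -/s szs // (leq_ltn_trans ab).
have s_ne : nth x0 s i != nth x0 s (i.+1 %% #|T|).
  by rewrite -szs; apply: nth_next_neq; rewrite ?szs.
have go u v (n : nat) : u != v -> (tau u + n) %% m = tau v -> n <= k -> dpower e k u v.
  move=> uv tuv dk; have [p []] := walk_along x0 (tau u) n cyc m0.
  rewrite -/m tuv modn_small ?(tauP _).1 // !(tauP _).2 => pth lst sz.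
  by rewrite -lst; apply: dpower_walk; rewrite ?lst ?sz.
have ix w : tau w = tau (nth x0 s (index w s)) by rewrite nth_index.
have ixT w : index w s < #|T| by rewrite -szs index_mem.
have [iT'|Ti] := ltnP i.+1 #|T|.
  move: s_ne; rewrite modn_small //.
  set u := nth x0 s i; set v := nth x0 s i.+1 => uv.
  have uv_le : tau u <= tau v by apply: s_le.
  (* Otherwise the window following that of [tau u] would contain a time strictly between those of
     the consecutive vertices [u] and [v]. *)
  have gap : tau v < (tau u %/ L).+2 * L.
    rewrite ltnNge; apply/negP => big.
    have [|w wj] := win (tau u %/ L).+1.
      by apply: leq_ltn_trans (tauP v).1; apply: leq_trans big; rewrite leq_mul2r leqnSn orbT.
    have w1 := leq_divM (tau w) L; have w2 := ltn_ceil (tau w) L0; rewrite wj in w1 w2.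
    have u2 := ltn_ceil (tau u) L0.
    have [wi|iw] := leqP (index w s) i.
      by have := s_le _ _ wi iT; rewrite -(ix w) -/u; lia.
    by have := s_le _ _ iw (ixT w); rewrite -(ix w) -/v; lia.
  have u1 := leq_divM (tau u) L.
  apply: (go _ _ (tau v - tau u)) => //; first by rewrite subnKC // modn_small // (tauP _).1.
  by rewrite !mulSn in gap; lia.
have iE : i.+1 = #|T| by apply/eqP; rewrite eqn_leq iT.
(* Wrapping around: [v] has its time in the first window and [u] in the last one, so the remaining
   part of the tour after [u] has at most [L] steps and [tau v < L]. *)
move: s_ne; rewrite iE modnn; set u := nth x0 s i; set v := nth x0 s 0 => uv.
have [w w0] := win 0 m0.
have vw : tau v <= tau w by rewrite (ix w); apply: s_le.
have wL : tau w < L by have := ltn_ceil (tau w) L0; rewrite w0 mul1n.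
have [|z zj] := win (m.-1 %/ L); first by have := leq_divM m.-1 L; lia.
have zu : tau z <= tau u by rewrite (ix z); apply: s_le => //; rewrite -ltnS iE.
have z1 := leq_divM (tau z) L; have m2 := ltn_ceil m.-1 L0; rewrite zj in z1.
rewrite mulSn in m2; have um := (tauP u).1.
apply: (go _ _ (m - tau u + tau v)) => //; last lia.
by rewrite addnA subnKC 1?ltnW // modnDl modn_small // (tauP v).1.
Qed.

(** * Distinct representatives of the windows of an Euler tour *)

Lemma tour_times A L c x0 : 1 < L -> uniq (arcs c) -> arcs c =i A -> (forall v, v \in c) ->
  (forall U, 0 < #|U| -> #|induced A U| < L.-1 * #|U|) ->
  exists2 tau : T -> nat, (forall v, tau v < size c /\ nth x0 c (tau v) = v) &
  (forall j, j * L < size c -> exists v, tau v %/ L = j).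
Proof.
move=> L1 uc cE cT sparse; have L0 := ltnW L1.
have m0 : 0 < size c by have := cT x0; case: (c).
set m := size c in m0 *; pose q := (m.-1 %/ L).+1.
have qP j : (j < q) = (j * L < m).
  by rewrite /q ltnS leq_divRL // -ltnS prednK.
pose N (j : 'I_q) := [set nth x0 c t | t : 'I_m & t %/ L == j].
have NP (j : 'I_q) t : t < m -> t %/ L = j -> nth x0 c t \in N j.
  by move=> tm tj; apply/imsetP; exists (Ordinal tm); rewrite // inE /= tj.
have hN : hall N.
  apply/forallP => W; have [->|[j jW]] := set_0Vmem W; first by rewrite cards0.
  set U := \bigcup_(i in W) N i.
  have NU i : i \in W -> N i \subset U by move=> iW; apply: bigcup_sup.
  have U0 : 0 < #|U|.
    apply/card_gt0P; exists (nth x0 c (j * L)); apply: (subsetP (NU j jW)).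
    by apply: NP; rewrite ?mulnK // -qP.
  (* The last window may be incomplete, so it is set aside. Each other window has [L.-1] arcs with
     both ends visited within it, and these arcs are all distinct because the tour repeats none. *)
  pose W' := W :\ ord_max.
  have W'P i (r : 'I_L.-1) : i \in W' -> (i * L + r).+1 < m.
    rewrite !inE -val_eqE /= => /andP [ne _]; have := ltn_ord i; rewrite /q ltnS leq_eqVlt.
    rewrite (negbTE ne) /= => lt; have : i.+1 * L <= m.-1 by rewrite -leq_divRL.
    by have := ltn_ord r; rewrite mulSn; move: (nat_of_ord r) (i * L) m0; lia.
  pose arc (p : 'I_q * 'I_L.-1) := nth (x0, x0) (arcs c) (p.1 * L + p.2).
  have rL (r : 'I_L.-1) : r < L by have := ltn_ord r; lia.
  have arc_inj : {in setX W' setT &, injective arc}.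
    move=> [i r] [i' r']; rewrite !inE !andbT -!in_setD1 => iW iW'.
    move/eqP; rewrite /arc nth_uniq ?size_arcs //=; try exact: ltnW (W'P _ _ _).
    move/eqP => E; have Ei := congr1 (divn ^~ L) E; have Er := congr1 (modn ^~ L) E.
    move: Ei Er; rewrite !divnMDl // !divn_small // !addn0 !modnMDl !modn_small // => Ei Er.
    by rewrite (ord_inj Ei) (ord_inj Er).
  have arc_in : [set arc p | p in setX W' setT] \subset induced A U.
    apply/subsetP => _ /imsetP [[i r] iW ->].
    have {}iW : i \in W' by move: iW; rewrite inE => /andP [].
    have lt := W'P i r iW; have iW0 : i \in W by move: iW; rewrite inE => /andP [].
    have r1 : r.+1 < L by have := ltn_ord r; lia.
    rewrite inE -cE mem_nth ?size_arcs ?(ltnW lt) //=.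
    rewrite /arc /arcs nth_zip ?size_rot //=; apply/andP; split; apply: (subsetP (NU i iW0)).
      by apply: NP; [exact: ltnW | rewrite divnMDl // divn_small // addn0].
    have -> : nth x0 (rot 1 c) (i * L + r) = nth x0 c (i * L + r).+1.
      by rewrite /rot nth_cat size_drop nth_drop subn1 -ltnS prednK // lt add1n.
    by apply: NP => //; rewrite -addnS divnMDl // divn_small // addn0.
  (* The strict inequality in [sparse] yields [#|W'| < #|U|], which leaves room for the last
     window. *)
  have := subset_leq_card arc_in; rewrite (card_in_imset arc_inj) cardsX cardsT card_ord.
  move/leq_ltn_trans/(_ (sparse U U0)); rewrite mulnC ltn_pmul2l; last lia.
  by rewrite (cardsD1 ord_max W) -/W'; case: (_ \in _) => //= /ltnW.
have [f finj fN] := hall_marriage hN.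
(* A vertex representing a window takes a visit inside that window as its time; any other vertex
   takes its first visit. Injectivity of [f] prevents conflicting demands. *)
have ex v : exists t : 'I_m, (nth x0 c t == v) && [forall j, (f j == v) ==> (t %/ L == j)].
  case: (boolP [exists j, f j == v]) => [/existsP [j /eqP fj]|/existsPn none].
    have := fN j; rewrite fj => /imsetP [t]; rewrite inE => tj vt.
    exists t; rewrite -vt eqxx; apply/forallP => j'; apply/implyP => /eqP fj'.
    by rewrite (finj j' j) // fj'.
  have vm : index v c < m by rewrite index_mem.
  exists (Ordinal vm); rewrite /= nth_index // eqxx; apply/forallP => j.
  by rewrite (negbTE (none j)).
have [tau tauP] := fin_all_exists ex.
exists (fun v => tau v) => [v|j]; first by have /andP [/eqP] := tauP v.
rewrite -qP => jq; exists (f (Ordinal jq)).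
have /andP [_ /forallP /(_ (Ordinal jq))] := tauP (f (Ordinal jq)).
by rewrite eqxx /= => /eqP.
Qed.

End Arcs.

(** * Choice of the window length and conclusion *)

Theorem theorem1p1 (T : finType) (e : rel T) (k : nat) :
  2 <= #|T| ->
  loopless e ->
  connected_digraph e ->
  eulerian e ->
  (* k = ceil (kbound #|T|) *)
  (INR k - 1 < kbound #|T| <= INR k)%R ->
  hamiltonian (dpower e k).
Proof.
move=> T1 _ ce ee [_ hk].
have [T23|T23] := ltnP #|T| 23.
  by apply: hamiltonian_small => //; apply: kbound_small => //; rewrite T1.
have k2 := kbound_large T23 hk.
have [s /andP [s1 s2]] := ceil_sqrt (ltnW T1).
have x0 : T by have /card_gt0P /sigW [x _] := ltnW T1.
have [|A minA AE] := @minset_exists _ (fun C => balanced C && conn C) [set a | e a.1 a.2].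
  by rewrite balanced_eulerian // conn_connected.
have [psi inj_psi back] := minimal_few_back_arcs x0 minA.
have /minsetP [/andP [bA cA] _] := minA.
have [c [uc cE]] := euler_tour bA cA.
(* This is the largest [L] with [2 * L <= k.+1]. *)
pose L := k.+1 %/ 2.
have s4 : 4 <= s.
  rewrite leqNgt; apply/negP => s3; have ss := leq_mul s3 s3.
  by move: s2 T23; rewrite /= Nat.mul_1_r; lia.
(* Indeed [k ^ 2 >= 102 * #|T|] and [#|T| > s ^ 2]. *)
have sk : 10 * s < k.
  rewrite ltnNge; apply/negP => ks; have kk := leq_mul ks ks.
  by move: s1 k2; rewrite /= !Nat.mul_1_r; lia.
have L5 : 5 * s < L by rewrite /L leq_divRL //; lia.
(* The number of arcs per vertex of [U] is at most [3 * s.+1] for large [U] and at most [s] for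
   small [U]; both are below [5 * s <= L.-1] because [s >= 4]. *)
have sparse (U : {set T}) : 0 < #|U| -> #|induced A U| < L.-1 * #|U|.
  move=> U0; have [sU|Us] := leqP s.+1 #|U|.
    apply: leq_ltn_trans (card_induced bA inj_psi s2 (ltnW back) sU) _.
    by rewrite mulnC ltn_pmul2r //; lia.
  by apply: leq_ltn_trans (induced_sq A U) _; rewrite ltn_pmul2r //; lia.
have cT v : v \in c by apply: mem_tour cE.
have L1 : 1 < L by lia.
have [tau tauP win] := tour_times x0 L1 uc cE cT sparse.
apply: (hamiltonian_of_times (L := L) (c := c) _ _ _ _ tauP win) => //; first lia.
  by have := leq_divM k.+1 2; rewrite -/L; lia.
rewrite cycle_arcs; apply/allP => a; rewrite cE => /(subsetP AE).
by rewrite inE.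
Qed.
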